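(* Let $\mathbb{K}$ be a field, let $\mathcal{I}$ be a monotone monomial ideal in $\mathbb{K}[x_1,\dots,x_n]$, and let $R$ be the set of monomials not belonging to $\mathcal{I}$ (the standard monomial basis of $\mathcal{A}=\mathbb{K}[x_1,\dots,x_n]/\mathcal{I}$). Let $\mathcal{J}$ be a deformation of $\mathcal{I}$ and $\mathcal{B}=\mathbb{K}[x_1,\dots,x_n]/\mathcal{J}$. Then the images of the monomials in $R$ linearly span $\mathcal{B}$.
   Context: A monotone monomial family is a collection $\{m_I\mid I\in\Sigma\}$ of monomials in $\mathbb{K}[x_1,\dots,x_n]$ indexed by a set $\Sigma$ of nonempty subsets of $\{1,\dots,n\}$ such that: (MM1) for $I\in\Sigma$, $m_I$ is a monomial in the variables $x_i$, $i\in I$; (MM2) for $I,J\in\Sigma$ with $I\subset J$ and $i\in I$, $\deg_{x_i}m_I\ge\deg_{x_i}m_J$; (MM3) for $I,J\in\Sigma$, $\mathrm{lcm}(m_I,m_J)$ is divisible by $m_K$ for some $K\in\Sigma$ with $K\supseteq I\cup J$. A monotone monomial ideal is an ideal $\mathcal{I}=\langle m_I\mid I\in\Sigma\rangle$ generated by such a family. For $I=\{i_1,\dots,i_r\}$ and a monomial $m\in\mathbb{K}[x_{i_1},\dots,x_{i_r}]$, an $I$-deformation of $m$ is a homogeneous $p\in\mathbb{K}[x_{i_1},\dots,x_{i_r}]$ of degree $\deg m$ with $\mathbb{K}[x_{i_1},\dots,x_{i_r}]=\langle R_m\rangle\oplus(p)$, where $\langle R_m\rangle$ is the span of monomials in $\mathbb{K}[x_{i_1},\dots,x_{i_r}]$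 not divisible by $m$ and $(p)$ is the ideal of that ring generated by $p$. A deformation of $\mathcal{I}=\langle m_I\mid I\in\Sigma\rangle$ is an ideal $\mathcal{J}=\langle p_I\mid I\in\Sigma\rangle$ with each $p_I$ an $I$-deformation of $m_I$. *)

(* Defs.v *)
From HB Require Import structures.
From mathcomp Require Export all_boot all_order all_algebra.
From mathcomp Require Export generic_quotient ring_quotient.
From mathcomp Require Export boolp.
From mathcomp.multinomials Require Export mpoly.

Set Implicit Arguments.
Unset Strict Implicit.
Unset Printing Implicit Defensive.

Import GRing.Theory.

#[export] Set Implicit Arguments.
#[export] Unset Strict Implicit.
#[export] Unset Printing Implicit Defensive.

Global Open Scope ring_scope.
Global Open Scope quotient_scope.

Definition in_span (K : fieldType) (V : lmodType K) (P : V -> Prop) (v : V) :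
    Prop :=
  exists (s : seq V) (c : V -> K),
    (forall w, w \in s -> P w) /\ v = \sum_(w <- s) c w *: w.

(* The ideal generated by the finite family (g i)_(i in S), possibly the whole
   ring. Membership is made boolean classically, as {ideal_quot _} requires. *)
Definition ideal_gen (A : comNzRingType) (T : finType) (S : {set T})
    (g : T -> A) : {pred A} :=
  fun f => `[< exists c : T -> A, f = \sum_(i in S) c i * g i >].

Section IdealGenClosed.
Variables (A : comNzRingType) (T : finType) (S : {set T}) (g : T -> A).

Lemma ideal_genP (f : A) :
  reflect (exists c : T -> A, f = \sum_(i in S) c i * g i)
          (f \in ideal_gen S g).
Proof. exact: asboolP. Qed.

Fact ideal_gen_zmod_closed : zmod_closed (ideal_gen S g).
Proof.
split=> [|_ _ /ideal_genP[c ->] /ideal_genP[d ->]]; apply/ideal_genP.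
  by exists (fun=> 0); rewrite big1 // => i _; rewrite mul0r.
exists (fun i => c i - d i); rewrite -sumrB.
by apply: eq_bigr => i _; rewrite mulrBl.
Qed.

HB.instance Definition _ :=
  GRing.isZmodClosed.Build A (ideal_gen S g) ideal_gen_zmod_closed.

Lemma ideal_genM (a f : A) :
  f \in ideal_gen S g -> a * f \in ideal_gen S g.
Proof.
move=> /ideal_genP[c ->]; apply/ideal_genP; exists (fun i => a * c i).
by rewrite mulr_sumr; apply: eq_bigr => i _; rewrite mulrA.
Qed.

End IdealGenClosed.

(* K[x_1, ..., x_n] / (g i | i in S) as a K-vector space. Only the
   additive quotient is taken from the library: its ring structure excludes the
   improper ideal, which occurs when some generator is a nonzero constant. *)
Definition mpoly_quot (K : fieldType) (n : nat) (T : finType) (S : {set T})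
    (g : T -> {mpoly K[n]}) : Type :=
  {ideal_quot (ideal_gen S g)}.

Section MpolyQuot.
Variables (K : fieldType) (n : nat) (T : finType) (S : {set T}).
Variable g : T -> {mpoly K[n]}.

Local Notation B := (mpoly_quot S g).
Local Notation Q := {ideal_quot (ideal_gen S g)}.

HB.instance Definition _ := GRing.Zmodule.on B.

Definition mpoly_proj (f : {mpoly K[n]}) : B := \pi_Q f.

Definition mpoly_quot_scale (a : K) (x : B) : B :=
  mpoly_proj (a *: repr (x : Q)).

Fact mpoly_proj_zmod_morphism : zmod_morphism mpoly_proj.
Proof. exact: (raddfB (\pi_Q)). Qed.

HB.instance Definition _ :=
  GRing.isZmodMorphism.Build {mpoly K[n]} B mpoly_proj
    mpoly_proj_zmod_morphism.

Lemma mpoly_proj_eq (f h : {mpoly K[n]}) :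
  (mpoly_proj f == mpoly_proj h) = (f - h \in ideal_gen S g).
Proof. by rewrite Quotient.idealrBE. Qed.

Lemma mpoly_projK (x : B) : mpoly_proj (repr (x : Q)) = x.
Proof. exact: reprK. Qed.

Fact mpoly_quot_scale_proj (a : K) (f : {mpoly K[n]}) :
  mpoly_quot_scale a (mpoly_proj f) = mpoly_proj (a *: f).
Proof.
apply/eqP; rewrite /mpoly_quot_scale mpoly_proj_eq -scalerBr -mul_mpolyC.
by apply: ideal_genM; rewrite -mpoly_proj_eq mpoly_projK.
Qed.

Fact mpoly_quot_scaleA (a b : K) (x : B) :
  mpoly_quot_scale a (mpoly_quot_scale b x) = mpoly_quot_scale (a * b) x.
Proof.
by rewrite -(mpoly_projK x) !mpoly_quot_scale_proj scalerA.
Qed.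

Fact mpoly_quot_scale1 : left_id 1 mpoly_quot_scale.
Proof. by move=> x; rewrite -(mpoly_projK x) mpoly_quot_scale_proj scale1r. Qed.

Fact mpoly_quot_scaleDr : right_distributive mpoly_quot_scale +%R.
Proof.
move=> a x y; rewrite -(mpoly_projK x) -(mpoly_projK y) -raddfD.
by rewrite !mpoly_quot_scale_proj scalerDr raddfD.
Qed.

Fact mpoly_quot_scaleDl (x : B) :
  {morph mpoly_quot_scale^~ x : a b / a + b}.
Proof.
move=> a b; rewrite -(mpoly_projK x).
by rewrite !mpoly_quot_scale_proj scalerDl raddfD.
Qed.

HB.instance Definition _ :=
  GRing.Zmodule_isLmodule.Build K B mpoly_quot_scaleA mpoly_quot_scale1
    mpoly_quot_scaleDr mpoly_quot_scaleDl.

Fact mpoly_proj_scalable : scalable mpoly_proj.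
Proof. by move=> a f; rewrite -mpoly_quot_scale_proj. Qed.

HB.instance Definition _ :=
  GRing.isScalable.Build K {mpoly K[n]} B *:%R mpoly_proj mpoly_proj_scalable.

End MpolyQuot.

Section Deformation.
Variables (K : fieldType) (n : nat).

Definition mnm_in (I : {set 'I_n}) (mu : 'X_{1..n}) : Prop :=
  forall i, i \notin I -> mu i = 0%N.

(* f belongs to the subring K[x_i | i in I]. *)
Definition mpoly_in (I : {set 'I_n}) (f : {mpoly K[n]}) : Prop :=
  forall mu, mu \in msupp f -> mnm_in I mu.

(* m is only meaningful on Sigma. *)
Record monotone_family (Sigma : {set {set 'I_n}})
    (m : {set 'I_n} -> 'X_{1..n}) : Prop := MonotoneFamily {
  monotone_nonempty : forall I, I \in Sigma -> I != set0;
  monotone_MM1 : forall I, I \in Sigma -> mnm_in I (m I);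
  monotone_MM2 : forall I J, I \in Sigma -> J \in Sigma -> I \subset J ->
    forall i, i \in I -> (m J i <= m I i)%N;
  monotone_MM3 : forall I J, I \in Sigma -> J \in Sigma ->
    exists L, [/\ L \in Sigma, I :|: J \subset L
                & (m L <= mlcm (m I) (m J))%MM]
}.

Definition nondiv_span (I : {set 'I_n}) (m : 'X_{1..n}) (f : {mpoly K[n]}) :
    Prop :=
  in_span (fun h => exists mu,
    [/\ mnm_in I mu, ~~ (m <= mu)%MM & h = 'X_[mu]]) f.

(* The ideal of the subring K[x_i | i in I] generated by p. *)
Definition sub_principal (I : {set 'I_n}) (p f : {mpoly K[n]}) : Prop :=
  exists2 q, mpoly_in I q & f = q * p.

(* The last two fields say K[x_i | i in I] = <R_m> (+) (p); both summands lie in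
   the left-hand side because p does. *)
Record I_deformation (I : {set 'I_n}) (m : 'X_{1..n}) (p : {mpoly K[n]}) :
    Prop := IDeformation {
  deformation_in : mpoly_in I p;
  deformation_homog : p \is (mdeg m).-homog;
  deformation_sum : forall f, mpoly_in I f -> exists r q,
    [/\ nondiv_span I m r, sub_principal I p q & f = r + q];
  deformation_direct : forall f,
    nondiv_span I m f -> sub_principal I p f -> f = 0
}.

Definition monomial_ideal (Sigma : {set {set 'I_n}})
    (m : {set 'I_n} -> 'X_{1..n}) : {pred {mpoly K[n]}} :=
  ideal_gen Sigma (fun I => 'X_[m I]).

Definition standard_monomial (Sigma : {set {set 'I_n}})
    (m : {set 'I_n} -> 'X_{1..n}) (mu : 'X_{1..n}) : Prop :=
  'X_[mu] \notin monomial_ideal Sigma m.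

End Deformation.

Arguments monomial_ideal K {n} Sigma m.
Arguments standard_monomial K {n} Sigma m mu.

(* Main.v *)
Require Import Defs.

Import GRing.Theory.

(** Rewrite a monomial [x^a] of the ideal with an index [I] of maximal cardinality
    such that [m_I] divides [x^a]: the deformation [p_I] replaces the [I]-part of
    [x^a] by a combination of monomials in the [x_i], [i \in I], not divisible by
    [m_I]. If [m_J] divides one of the new monomials, then (MM2) and (MM3) provide
    [L] containing [I] and [J] with [m_L] dividing [x^a], so that [L = I] by
    maximality, and [J] is a proper subset of [I]. Hence the maximal cardinality
    drops at each step and the rewriting terminates. *)

Section InSpan.
Variables (K : fieldType) (V : lmodType K) (P : V -> Prop).

(* Repeated vectors in [r] are merged, since [in_span] attaches the coefficient
   to the vector and not to its position in the list. *)
Lemma in_span_lincomb (r : seq (K * V)) :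
  (forall u, u \in r -> P u.2) -> in_span P (\sum_(u <- r) u.1 *: u.2).
Proof.
move=> Pr; exists (undup [seq u.2 | u <- r]).
exists (fun w => \sum_(u <- r | u.2 == w) u.1); split.
  by move=> w; rewrite mem_undup => /mapP[u /Pr Pu ->].
under [RHS]eq_bigr do rewrite scaler_suml.
rewrite (exchange_big_dep predT) //= big_seq [RHS]big_seq.
apply: eq_bigr => u ur.
(* After the exchange of sums, each pair [u] contributes only at [w = u.2], which occurs exactly
   once in the duplicate-free list. *)
rewrite big_mkcond (bigD1_seq u.2) ?undup_uniq ?mem_undup ?map_f //= eqxx.
by rewrite big1 ?addr0 // => w /negbTE; rewrite eq_sym => ->.
Qed.

Lemma in_span_incl (w : V) : P w -> in_span P w.
Proof.
move=> Pw; exists [:: w], (fun=> 1); split=> [x|].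
  by rewrite inE => /eqP ->.
by rewrite big_seq1 scale1r.
Qed.

Lemma in_span0 : in_span P 0.
Proof. by exists [::], (fun=> 0); rewrite big_nil. Qed.

Lemma in_spanZ (a : K) (v : V) : in_span P v -> in_span P (a *: v).
Proof.
move=> [s [c [Ps ->]]]; exists s, (fun w => a * c w); split=> //.
by rewrite scaler_sumr; apply: eq_bigr => w _; rewrite scalerA.
Qed.

Lemma in_spanD (v w : V) : in_span P v -> in_span P w -> in_span P (v + w).
Proof.
move=> [s [c [Ps ->]]] [t [d [Pt ->]]].
(* The coefficient functions [c] and [d] may disagree on a vector common to [s] and [t], so each
   vector is paired with its own coefficient before concatenating. *)
have := @in_span_lincomb ([seq (c x, x) | x <- s] ++ [seq (d x, x) | x <- t]).
rewrite big_cat !big_map /=; apply=> u.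
by rewrite mem_cat => /orP[] /mapP[x xs ->]; [apply: Ps | apply: Pt].
Qed.

Lemma in_span_sum (T : eqType) (r : seq T) (F : T -> V) :
  (forall i, i \in r -> in_span P (F i)) -> in_span P (\sum_(i <- r) F i).
Proof.
move=> PF; rewrite big_seq.
by apply: big_ind => //; [exact: in_span0 | exact: in_spanD].
Qed.

End InSpan.

Section MonotoneReduction.
Variables (K : fieldType) (n : nat) (Sigma : {set {set 'I_n}}).
Variables (m : {set 'I_n} -> 'X_{1..n}) (p : {set 'I_n} -> {mpoly K[n]}).

(** If no generator divided ['X_[a]], every product [c I * 'X_[m I]] would have coefficient 0 at
    [a], whereas ['X_[a]] has coefficient 1 there. *)
Lemma monomial_ideal_divisor (a : 'X_{1..n}) :
  'X_[a] \in monomial_ideal K Sigma m ->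
  exists2 I, I \in Sigma & (m I <= a)%MM.
Proof.
move=> /ideal_genP[c Ea].
case: (pickP [pred I | (I \in Sigma) && (m I <= a)%MM]) => [I /andP[]|none].
  by exists I.
move/(congr1 (mcoeff a)): Ea; rewrite mcoeffX eqxx raddf_sum big1 => [/eqP|I IS].
  by rewrite oner_eq0.
apply/eqP; rewrite mcoeff_eq0 (perm_mem (msuppMX _ _)).
apply/mapP=> -[mu _ Emu].
by have := none I; rewrite /= IS Emu lem_addr.
Qed.

Definition mnm_restrict (I : {set 'I_n}) (a : 'X_{1..n}) : 'X_{1..n} :=
  [multinom if i \in I then a i else 0%N | i < n].

Lemma mnm_restrict_split (I : {set 'I_n}) (a : 'X_{1..n}) :
  (mnm_restrict I a + mnm_restrict (~: I) a)%MM = a.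
Proof.
by apply/mnmP => i; rewrite mnmDE !mnmE inE; case: (i \in I); rewrite ?addn0.
Qed.

Lemma mnm_restrict_in (I : {set 'I_n}) (a : 'X_{1..n}) :
  mnm_in I (mnm_restrict I a).
Proof. by move=> i /negbTE iI; rewrite mnmE iI. Qed.

Lemma reduced_divisor_proper (I J : {set 'I_n}) (a mu : 'X_{1..n}) :
  monotone_family Sigma m -> I \in Sigma -> J \in Sigma ->
  (m I <= a)%MM ->
  (forall L, L \in Sigma -> (m L <= a)%MM -> (#|L| <= #|I|)%N) ->
  mnm_in I mu -> ~~ (m I <= mu)%MM ->
  (m J <= mu + mnm_restrict (~: I) a)%MM -> (#|J| < #|I|)%N.
Proof.
move=> hm IS JS /mnm_lepP mIa maxI muI mImu /mnm_lepP mJ.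
have [L [LS]] := monotone_MM3 hm IS JS.
rewrite subUset => /andP[IL JL] /mnm_lepP mL.
have mLa : (m L <= a)%MM.
  (* On [I], (MM2) bounds [m L] by [m I]. Off [I], [m I] vanishes by (MM1), so the lcm has the
     exponent of [m J], and [mu] vanishes too, which leaves the bound [a i]. *)
  apply/mnm_lepP => i; case: (boolP (i \in I)) => iI.
    exact: leq_trans (monotone_MM2 hm IS LS IL iI) (mIa i).
  apply: leq_trans (mL i) _.
  rewrite mnmE (monotone_MM1 hm IS iI) max0n; apply: leq_trans (mJ i) _.
  by rewrite mnmDE mnmE inE iI (muI _ iI).
have EL : I = L by apply/eqP; rewrite eqEcard IL maxI.
rewrite -EL in JL; apply: proper_card; rewrite properEneq JL andbT.
(* If [J = I], then [m I] would divide [mu], since the factor restricted to [~: I] contributes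
   nothing on [I]. *)
apply: contraNneq mImu => EJ; apply/mnm_lepP => i.
case: (boolP (i \in I)) => iI; last by rewrite (monotone_MM1 hm IS iI).
by have := mJ i; rewrite EJ mnmDE mnmE inE iI addn0.
Qed.

Lemma mpoly_proj_ideal (f : {mpoly K[n]}) :
  f \in ideal_gen Sigma p -> mpoly_proj Sigma p f = 0.
Proof.
by move=> fJ; apply/eqP; rewrite -(raddf0 (mpoly_proj Sigma p)) mpoly_proj_eq subr0.
Qed.

Lemma generator_in_ideal (I : {set 'I_n}) :
  I \in Sigma -> p I \in ideal_gen Sigma p.
Proof.
move=> IS; apply/ideal_genP; exists (fun J => (J == I)%:R).
rewrite (bigD1 I) //= eqxx mul1r big1 ?addr0 // => J /andP[_ /negbTE ->].
by rewrite mul0r.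
Qed.

(** Induction on [k], a strict bound on the cardinalities of the indices whose monomial divides
    ['X_[a]]. For [k = 0] there is no such index, so [a] is standard. *)
Lemma monomial_in_span (k : nat) (a : 'X_{1..n}) :
  monotone_family Sigma m ->
  (forall I, I \in Sigma -> I_deformation I (m I) (p I)) ->
  (forall J, J \in Sigma -> (m J <= a)%MM -> (#|J| < k)%N) ->
  in_span
    (fun w : mpoly_quot Sigma p =>
       exists2 mu, standard_monomial K Sigma m mu & w = mpoly_proj Sigma p 'X_[mu])
    (mpoly_proj Sigma p 'X_[a]).
Proof.
move=> hm hp; elim: k a => [|k IHk] a ltk;
  have [/monomial_ideal_divisor[I0 I0S mI0]|std] :=
    boolP ('X_[a] \in monomial_ideal K Sigma m);
  try by apply: in_span_incl; exists a.
  by have := ltk _ I0S mI0.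
pose divides_a := [pred I | (I \in Sigma) && (m I <= a)%MM].
have PI0 : divides_a I0 by rewrite /= I0S.
have [I /andP[IS mI] maxI] :=
  @arg_maxnP _ I0 divides_a (fun I : {set 'I_n} => #|I|) PI0.
have Xin : mpoly_in I ('X_[mnm_restrict I a] : {mpoly K[n]}).
  by move=> mu; rewrite msuppX inE => /eqP ->; apply: mnm_restrict_in.
have [_ [_ [[s [c [Ps ->]]] [q _ ->] E]]] := deformation_sum (hp _ IS) Xin.
(* Multiplied by the part of ['X_[a]] outside [I], the component in [(p I)] lies in the deformed
   ideal and dies in the quotient. *)
rewrite -[in 'X_[a]](mnm_restrict_split I a) mpolyXD E mulrDl raddfD /=.
rewrite [X in _ + X]mpoly_proj_ideal ?addr0; last first.
  by rewrite mulrAC; apply: ideal_genM; apply: generator_in_ideal.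
rewrite mulr_suml raddf_sum; apply: in_span_sum => h /Ps[mu [muI mImu ->]].
rewrite -scalerAl /= mpoly_proj_scalable; apply: in_spanZ; rewrite -mpolyXD.
apply: IHk => J JS mJ; rewrite -ltnS; apply: leq_trans (ltk _ IS mI); rewrite ltnS.
apply: reduced_divisor_proper hm IS JS mI _ muI mImu mJ => L LS mL.
by apply: maxI; rewrite /= LS.
Qed.

End MonotoneReduction.

Theorem theorem5p2 (K : fieldType) (n : nat) (Sigma : {set {set 'I_n}})
    (m : {set 'I_n} -> 'X_{1..n}) (p : {set 'I_n} -> {mpoly K[n]})
    (hm : monotone_family Sigma m)
    (hp : forall I : {set 'I_n}, I \in Sigma -> I_deformation I (m I) (p I))
    (b : mpoly_quot Sigma p) :
  in_span
    (fun w : mpoly_quot Sigma p =>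
       exists2 mu : 'X_{1..n},
         standard_monomial K Sigma m mu & w = mpoly_proj Sigma p 'X_[mu])
    b.
Proof.
rewrite -(mpoly_projK b) [repr _]mpolyE raddf_sum.
apply: in_span_sum => a _; rewrite /= mpoly_proj_scalable; apply: in_spanZ.
(* A subset of ['I_n] has at most [n] elements and the bound is strict, hence [n.+1]. *)
apply: (@monomial_in_span _ _ _ _ _ n.+1) => // J _ _.
by rewrite ltnS -[X in (_ <= X)%N]card_ord max_card.
Qed.
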